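(* Let $a<b$ be real numbers, let $n\ge 1$ be an integer, and let $f:[a,b]\to\mathbb{R}$ be an $n$-times continuously differentiable mapping such that $\|f^{(n)}\|_\infty<\infty$. Then for all $\theta\in[0,1]$, $$|I-F_n|\le \frac{(b-a)^{n+1}}{(n+1)!\,2^n}\,\|f^{(n)}\|_\infty\times\begin{cases}\theta(n+1)-1, & \text{if } \theta n\ge 1,\\ 2\theta^{n+1}n^n-\theta(n+1)+1, & \text{if } 0\le\theta n<1.\end{cases}$$
   Context: Notation: $I=\int_a^b f(x)\,dx$, and, for the parameter $\theta\in[0,1]$, $$F_n=(b-a)\left[(1-\theta)f\left(\tfrac{a+b}{2}\right)+\theta\,\tfrac{f(a)+f(b)}{2}\right]+\sum_{i=1}^{\lfloor (n-1)/2\rfloor}\frac{[1-\theta(2i+1)](b-a)^{2i+1}}{(2i+1)!\,2^{2i}}\,f^{(2i)}\left(\tfrac{a+b}{2}\right),$$ where $\lfloor\cdot\rfloor$ is the integer part and an empty sum is $0$. $\|f^{(n)}\|_\infty=\sup_{x\in(a,b)}|f^{(n)}(x)|$. *)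

(* Defs.v *)
From Stdlib Require Import Arith Reals.
From Coquelicot Require Import Coquelicot.
Open Scope R_scope.

(** Stdlib reals with Coquelicot. A function on [[a, b]] is the restriction of
    some [f : R -> R]; the values of [f] outside [[a, b]] are irrelevant. *)

Definition segment (a b x : R) : Prop := a <= x <= b.

(** Same as [is_derive f x l], with the increments confined to [[a, b]]; hence
    the derivative is one-sided when [x] is an endpoint. *)
Definition is_derive_on (a b : R) (f : R -> R) (x l : R) : Prop :=
  filterdiff f (within (segment a b) (locally x)) (fun h : R => scal h l).

Fixpoint Cn_on (n : nat) (a b : R) (f : R -> R) : Prop :=
  match n with
  | O => continuous_on (segment a b) f
  | S m => exists g : R -> R,
      (forall x, segment a b x -> is_derive_on a b f x (g x)) /\ Cn_on m a b g
  end.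

(** The supremum is over the open interval, where [Derive_n f n] depends only on
    the restriction of [f] to [[a, b]]. *)
Definition sup_norm (a b : R) (g : R -> R) : Rbar :=
  Lub_Rbar (fun y => exists x, a < x < b /\ y = Rabs (g x)).

(** The sum is empty, hence [0], when [(n - 1) / 2 = 0]. *)
Definition quadrature (a b theta : R) (n : nat) (f : R -> R) : R :=
  (b - a) * ((1 - theta) * f ((a + b) / 2) + theta * ((f a + f b) / 2))
  + sum_n_m
      (fun i : nat =>
         (1 - theta * INR (2 * i + 1)) * (b - a) ^ (2 * i + 1)
         / (INR (fact (2 * i + 1)) * 2 ^ (2 * i))
         * Derive_n f (2 * i) ((a + b) / 2))
      1 ((n - 1) / 2).

(* Main.v *)
(** Put [h = (b - a) / 2], [c = theta h] and
    [P_k(t) = (t^k - k c t^(k-1)) / k!], so that [P_0 = 1] and [P_(k+1)' = P_k].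
    On each half of the interval, measured by the distance [t] to the endpoint,
    [n] integrations by parts give the integral of [f] as boundary terms plus
    [+-] the integral of [P_n f^(n)] over [[0, h]]. The boundary terms at the
    midpoint cancel for odd derivatives and double for even ones, which yields
    the quadrature formula. As [P_n] changes sign on [[0, h]] only at
    [t = n theta h], and not at all when [n theta >= 1], the integral of [|P_n|]
    is explicit and has the two stated cases. *)

Require Import Defs.
From Stdlib Require Import Arith Reals.
From Coquelicot Require Import Coquelicot.
From Stdlib Require Import Lra Lia.
Open Scope R_scope.

(** * Extension of a function from the segment to the whole line *)

Definition clamp (a b x : R) : R := Rmax a (Rmin b x).

Lemma clamp_segment (a b x : R) : a <= b -> segment a b (clamp a b x).
Proof. unfold segment, clamp, Rmax, Rmin; repeat destruct Rle_dec; lra. Qed.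

Lemma clamp_id (a b x : R) : segment a b x -> clamp a b x = x.
Proof. unfold segment, clamp, Rmax, Rmin; repeat destruct Rle_dec; lra. Qed.

Lemma clamp_lipschitz (a b x y : R) :
  Rabs (clamp a b y - clamp a b x) <= Rabs (y - x).
Proof.
  unfold clamp, Rmax, Rmin; repeat destruct Rle_dec;
    unfold Rabs; repeat destruct Rcase_abs; lra.
Qed.

(** The clamp is 1-Lipschitz with values in the segment, so near [x] it tends to [clamp a b x]
    within the segment. *)
Lemma continuous_clamp (a b : R) (f : R -> R) :
  a <= b -> continuous_on (segment a b) f ->
  forall x, continuous (fun y => f (clamp a b y)) x.
Proof.
  intros hab hf x.
  apply (filterlim_comp _ _ _ (clamp a b) f _
           (within (segment a b) (locally (clamp a b x)))).
  2: now apply hf, clamp_segment.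
  intros P [d Hd].
  exists d; intros y Hy.
  apply Hd; [|now apply clamp_segment].
  eapply Rle_lt_trans; [apply clamp_lipschitz|exact Hy].
Qed.

Lemma is_derive_on_continuous (a b : R) (f g : R -> R) :
  (forall x, segment a b x -> is_derive_on a b f x (g x)) ->
  continuous_on (segment a b) f.
Proof.
  intros hf x hx.
  apply (filterdiff_continuous_aux (F := within (segment a b) (locally x)) f).
  - exists (fun h : R => scal h (g x)); now apply hf.
  - intros P; unfold within; apply filter_imp; auto.
Qed.

Lemma locally_interior (a b x : R) :
  a < x < b -> locally x (fun y => a < y < b).
Proof.
  intros hx.
  apply (locally_open (fun y => a < y < b)); auto.
  apply open_and; [apply open_gt|apply open_lt].
Qed.

Lemma is_derive_on_interior (a b : R) (f : R -> R) (x l : R) :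
  a < x < b -> is_derive_on a b f x l -> is_derive f x l.
Proof.
  intros hx [hlin hdom]; split; [exact hlin|].
  intros y hy eps.
  assert (hy' : is_filter_lim (within (segment a b) (locally x)) y).
  { intros P HP; apply hy in HP; revert HP; unfold within; apply filter_imp; auto. }
  generalize (filter_and _ _ (locally_interior a b x hx) (hdom y hy' eps)).
  apply filter_imp; intros z [hz H].
  apply H; unfold segment; lra.
Qed.

(** Explicit two-sided derivatives on the whole line, endpoints included; [Derive_n f] would not
    supply them at [a] and [b], where it sees the arbitrary outside values of [f]. Entries beyond
    index [n] are unconstrained. *)
Definition derive_chain (n : nat) (G : nat -> R -> R) : Prop :=
  (forall k x, (k < n)%nat -> is_derive (G k) x (G (S k) x))
  /\ (forall x, continuous (G n) x).

Lemma derive_chain_continuous (n : nat) (G : nat -> R -> R) (k : nat) (x : R) :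
  derive_chain n G -> (k <= n)%nat -> continuous (G k) x.
Proof.
  intros [hd hc] hk.
  destruct (Nat.eq_dec k n) as [->|hne]; [apply hc|].
  apply (ex_derive_continuous (G k)).
  exists (G (S k) x); apply hd; lia.
Qed.

(* The top derivative is extended by constants and then integrated back up; the
   differentiability of the given functions is thereby made two-sided. *)
Lemma Cn_on_extend (n : nat) (a b : R) (f : R -> R) :
  a < b -> Cn_on n a b f ->
  exists G : nat -> R -> R,
    (forall x, segment a b x -> G O x = f x) /\ derive_chain n G.
Proof.
  intros hab; revert f; induction n as [|n IH]; intros f hf.
  - exists (fun _ x => f (clamp a b x)); split.
    + intros x hx; now rewrite clamp_id.
    + split; [intros; lia|].
      apply continuous_clamp; [lra|exact hf].
  - destruct hf as [g [hfg hg]].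
    destruct (IH g hg) as [G [hG0 hG]].
    set (F := fun x => f a + RInt (G O) a x).
    assert (hc : forall x, continuous (G O) x)
      by (intros x; apply (derive_chain_continuous n); [exact hG|lia]).
    assert (hF : forall x, is_derive F x (G O x)).
    { intros x.
      replace (G O x) with (0 + G O x) by ring.
      apply (is_derive_plus (fun _ => f a)).
      - apply @is_derive_const.
      - apply (is_derive_RInt (G O) _ a); [|apply hc].
        apply filter_forall; intros y.
        apply (RInt_correct (G O)), ex_RInt_continuous; intros; apply hc. }
    exists (fun k => match k with O => F | S k => G k end); split.
    + intros x hx.
      (* The difference vanishes at [a] and has derivative 0 inside. It is clamped because the mean
         value theorem asks for two-sided continuity at the ends, where [f] itself may jump. *)
      destruct (MVT_gen (fun y => F (clamp a b y) - f (clamp a b y)) a x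
                  (fun _ => 0)) as [c [_ hcx]].
      * intros y hy.
        unfold segment in hx; rewrite Rmin_left, Rmax_right in hy by lra.
        apply (is_derive_ext_loc (fun y => F y - f y)).
        { generalize (locally_interior a b y ltac:(lra)).
          apply filter_imp; intros z hz.
          rewrite clamp_id; [easy|unfold segment; lra]. }
        replace 0 with (G O y - g y)
          by (rewrite hG0; [ring|unfold segment; lra]).
        apply (is_derive_minus F f); [apply hF|].
        apply (is_derive_on_interior a b); [lra|].
        apply hfg; unfold segment; lra.
      * intros y _.
        apply continuity_pt_filterlim.
        apply (continuous_minus (fun y => F (clamp a b y))
                 (fun y => f (clamp a b y))).
        -- apply continuous_clamp; [lra|].
           apply continuous_on_forall; intros z _.
           apply (ex_derive_continuous F); exists (G O z); apply hF.
        -- apply continuous_clamp; [lra|].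
           now apply (is_derive_on_continuous a b f g).
      * rewrite (clamp_id a b x hx), (clamp_id a b a) in hcx
          by (unfold segment; lra).
        assert (F a = f a).
        { unfold F; rewrite RInt_point; apply Rplus_0_r. }
        lra.
    + split.
      * intros [|k] x hk; [apply hF|].
        apply hG; lia.
      * apply hG.
Qed.

(** A point of the open interval has a neighbourhood on which [f] and [G O] agree, so agreement
    passes from each derivative to the next. *)
Lemma Derive_n_derive_chain (n : nat) (a b : R) (f : R -> R)
    (G : nat -> R -> R) :
  (forall x, segment a b x -> G O x = f x) -> derive_chain n G ->
  forall k x, (k <= n)%nat -> a < x < b -> Derive_n f k x = G k x.
Proof.
  intros h0 [hd _] k; induction k as [|k IH]; intros x hk hx.
  - symmetry; apply h0; unfold segment; lra.
  - simpl.
    rewrite (Derive_ext_loc (Derive_n f k) (G k)).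
    + apply is_derive_unique, hd; lia.
    + generalize (locally_interior a b x hx); apply filter_imp.
      intros y hy; apply IH; [lia|exact hy].
Qed.

Lemma sup_norm_ub (a b : R) (g : R -> R) (x : R) :
  Rbar_lt (sup_norm a b g) p_infty -> a < x < b ->
  Rabs (g x) <= real (sup_norm a b g).
Proof.
  unfold sup_norm; intros h hx.
  destruct (Lub_Rbar_correct (fun y => exists x, a < x < b /\ y = Rabs (g x)))
    as [hub _].
  specialize (hub (Rabs (g x)) ltac:(now exists x)).
  (* [p_infty] contradicts finiteness and [m_infty] lies below [Rabs (g x)]; hence [real] never
     takes its default value 0 here. *)
  destruct (Lub_Rbar _); [exact hub|easy|easy].
Qed.

(** * The Peano kernel and repeated integration by parts *)

(** For [k >= 1] this is [t^(k-1) (t - k c) / k!]. At [k = 0] the factor [INR 0] removes the term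
    with the truncated [pred]. *)
Definition peano_kernel (c : R) (k : nat) (t : R) : R :=
  (t ^ k - INR k * c * t ^ pred k) / INR (fact k).

Lemma fact_S_R (k : nat) : INR (fact (S k)) = INR (S k) * INR (fact k).
Proof. rewrite fact_simpl; apply mult_INR. Qed.

Lemma is_derive_peano_kernel (c : R) (k : nat) (t : R) :
  is_derive (peano_kernel c (S k)) t (peano_kernel c k t).
Proof.
  pose proof (INR_fact_neq_0 k) as hk.
  assert (hS : INR (S k) <> 0) by (apply not_0_INR; lia).
  unfold peano_kernel; simpl pred; rewrite fact_S_R.
  auto_derive; [easy|].
  fold (INR (S k)); field; auto.
Qed.

Lemma continuous_peano_kernel (c : R) (k : nat) (t : R) :
  continuous (peano_kernel c k) t.
Proof.
  apply (ex_derive_continuous (peano_kernel c k)).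
  unfold peano_kernel; auto_derive; easy.
Qed.

(** A factor [t] remains from index 2 on. Index 1 is excluded: [P_1(0) = -c] is what gives the
    endpoint values of [f] their weight. *)
Lemma peano_kernel_0 (c : R) (k : nat) : peano_kernel c (S (S k)) 0 = 0.
Proof. unfold peano_kernel; simpl pred; rewrite !pow_ne_zero by lia; lra. Qed.

(* Repeated integration by parts: all terms of the derivative of the sum cancel
   except the first and the last. *)
Lemma is_derive_by_parts (c : R) (N : nat) (u : nat -> R -> R) (t : R) :
  (forall k, (k <= N)%nat -> is_derive (u k) t (u (S k) t)) ->
  is_derive
    (fun t => sum_n (fun k => (-1) ^ k * (peano_kernel c (S k) t * u k t)) N) t
    (u O t + (-1) ^ N * (peano_kernel c (S N) t * u (S N) t)).
Proof.
  assert (hstep : forall k, is_derive (u k) t (u (S k) t) ->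
    is_derive (fun t => (-1) ^ k * (peano_kernel c (S k) t * u k t)) t
      ((-1) ^ k * (peano_kernel c k t * u k t
                   + peano_kernel c (S k) t * u (S k) t))).
  { intros k hk; apply is_derive_scal.
    apply (is_derive_mult (peano_kernel c (S k)) (u k));
      [apply is_derive_peano_kernel|exact hk|intros; apply Rmult_comm]. }
  induction N as [|N IH]; intros hu.
  - apply is_derive_ext with
      (fun t => (-1) ^ 0 * (peano_kernel c 1 t * u O t)).
    { intros s; now rewrite sum_O. }
    replace (u O t + _) with
      ((-1) ^ 0 * (peano_kernel c 0 t * u O t + peano_kernel c 1 t * u 1%nat t)).
    + apply hstep, hu; lia.
    + unfold peano_kernel at 1; simpl; field.
  - apply is_derive_ext with
      (fun t => sum_n (fun k => (-1) ^ k * (peano_kernel c (S k) t * u k t)) N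
         + (-1) ^ S N * (peano_kernel c (S (S N)) t * u (S N) t)).
    { intros s; now rewrite sum_Sn. }
    replace (u O t + _) with
      (u O t + (-1) ^ N * (peano_kernel c (S N) t * u (S N) t)
       + (-1) ^ S N * (peano_kernel c (S N) t * u (S N) t
           + peano_kernel c (S (S N)) t * u (S (S N)) t))
      by (simpl; ring).
    apply (is_derive_plus (V := R_NormedModule)); [apply IH|apply hstep];
      intros; apply hu; lia.
Qed.

(** * Sign of the kernel and integral of its absolute value *)

(** If [s] is the constant sign of [P], then [M * s * P] dominates [|P u|] and has the primitive
    [M * s * Q]. Comparison on the open interval suffices, which matches the domain of
    [sup_norm]. *)
Lemma RInt_constant_sign_bound (p q s M : R) (P Q u : R -> R) :
  p <= q ->
  (forall t, is_derive Q t (P t)) -> (forall t, continuous P t) ->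
  (forall t, continuous u t) ->
  (forall t, p < t < q -> Rabs (P t) = s * P t) ->
  (forall t, p < t < q -> Rabs (u t) <= M) ->
  Rabs (RInt (fun t => P t * u t) p q) <= M * (s * (Q q - Q p)).
Proof.
  intros hpq hQ hP hu hs hM.
  assert (hex : is_RInt (fun t => P t * u t) p q (RInt (fun t => P t * u t) p q)).
  { apply (RInt_correct (fun t => P t * u t)), ex_RInt_continuous; intros t _.
    now apply (continuous_mult P u). }
  assert (hK : forall e, is_RInt (fun t => e * P t) p q (e * (Q q - Q p))).
  { intros e; apply (is_RInt_scal P).
    apply (is_RInt_derive Q P); auto. }
  assert (hb : forall t, p < t < q -> Rabs (P t * u t) <= M * s * P t).
  { intros t ht; rewrite Rabs_mult.
    rewrite Rmult_assoc, <- (hs t ht), (Rmult_comm M).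
    apply Rmult_le_compat_l; [apply Rabs_pos|now apply hM]. }
  apply Rabs_le; split.
  - replace (- _) with (- (M * s) * (Q q - Q p)) by ring.
    apply (is_RInt_le _ _ p q _ _ hpq (hK (- (M * s))) hex).
    intros t ht; pose proof (hb t ht) as H; apply Rabs_le_between in H; lra.
  - replace (M * _) with (M * s * (Q q - Q p)) by ring.
    apply (is_RInt_le _ _ p q _ _ hpq hex (hK (M * s))).
    intros t ht; pose proof (hb t ht) as H; apply Rabs_le_between in H; lra.
Qed.

(** For [t >= 0] the sign of the kernel is that of its linear factor [t - (N+1) c]. *)
Lemma Rabs_peano_kernel (c : R) (N : nat) (t : R) :
  0 <= t ->
  (t <= INR (S N) * c ->
   Rabs (peano_kernel c (S N) t) = -1 * peano_kernel c (S N) t) /\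
  (INR (S N) * c <= t ->
   Rabs (peano_kernel c (S N) t) = 1 * peano_kernel c (S N) t).
Proof.
  intros ht.
  assert (hf : 0 <= t ^ N / INR (fact (S N))).
  { apply Rdiv_le_0_compat; [now apply pow_le|apply INR_fact_lt_0]. }
  assert (he : peano_kernel c (S N) t
               = t ^ N / INR (fact (S N)) * (t - INR (S N) * c)).
  { unfold peano_kernel; simpl pred; rewrite <- tech_pow_Rmult; field.
    apply INR_fact_neq_0. }
  rewrite he; split; intros h.
  - rewrite Rabs_left1; [ring|]. nra.
  - rewrite Rabs_pos_eq; [ring|]. nra.
Qed.

(** For [n >= 1] and [c = theta h], this is the integral of [|P_n|] over [[0, h]], divided by
    [h^(n+1) / (n+1)!]. *)
Definition quadrature_constant (theta : R) (n : nat) : R :=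
  if Rle_dec 1 (theta * INR n)
  then theta * INR (n + 1) - 1
  else 2 * theta ^ (n + 1) * INR n ^ n - theta * INR (n + 1) + 1.

Lemma RInt_peano_kernel_bound (h theta M : R) (N : nat) (u : R -> R) :
  0 < h -> 0 <= theta -> (forall t, continuous u t) ->
  (forall t, 0 < t < h -> Rabs (u t) <= M) ->
  Rabs (RInt (fun t => peano_kernel (theta * h) (S N) t * u t) 0 h)
  <= M * (h ^ (S N + 1) / INR (fact (S N + 1))
          * quadrature_constant theta (S N)).
Proof.
  intros hh hth hu hM.
  set (c := theta * h).
  assert (hc : 0 <= c) by (unfold c; nra).
  assert (hsign := Rabs_peano_kernel c N).
  assert (hb := fun p q s hpq hs hM => RInt_constant_sign_bound p q s M _ _ u hpq
    (is_derive_peano_kernel c (S N)) (continuous_peano_kernel c (S N)) hu hs hM).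
  assert (hnz := INR_fact_neq_0 (S (S N))).
  pose proof (pos_INR (S N)) as hN.
  unfold quadrature_constant; rewrite !Nat.add_1_r.
  destruct Rle_dec as [hle|hgt].
  (* The root [n c] is at least [h], so the kernel is nonpositive on all of [[0, h]]. *)
  - eapply Rle_trans; [apply (hb 0 h (-1)); [lra| |exact hM]|].
    + intros t ht; apply hsign; [lra|].
      unfold c; nra.
    + right; rewrite peano_kernel_0; unfold peano_kernel, c; simpl pred.
      rewrite <- tech_pow_Rmult; field; exact hnz.
  - assert (hch : INR (S N) * c < h) by (unfold c; nra).
    assert (h0c : 0 <= INR (S N) * c) by nra.
    assert (hex : forall p q,
      ex_RInt (fun t => peano_kernel c (S N) t * u t) p q).
    { intros p q; apply (@ex_RInt_continuous R_CompleteNormedModule); intros t _.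
      apply (continuous_mult (peano_kernel c (S N)) u); [|apply hu].
      apply continuous_peano_kernel. }
    rewrite <- (RInt_Chasles _ 0 (INR (S N) * c) h) by apply hex.
    eapply Rle_trans; [apply Rabs_triang|].
    eapply Rle_trans; [apply Rplus_le_compat|].
    + apply (hb 0 (INR (S N) * c) (-1)); [exact h0c| |].
      * intros t ht; apply hsign; lra.
      * intros t ht; apply hM; lra.
    + apply (hb (INR (S N) * c) h 1); [lra| |].
      * intros t ht; apply hsign; lra.
      * intros t ht; apply hM; lra.
    (* With [n = S N], the two pieces add up to [P_(n+1)(h) - 2 P_(n+1)(n c)], and
       [P_(n+1)(n c) = - n^n c^(n+1) / (n+1)!]. *)
    + right; rewrite peano_kernel_0; unfold peano_kernel, c; simpl pred.
      rewrite !Rpow_mult_distr, <- !tech_pow_Rmult, (S_INR (S N)).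
      field; exact hnz.
Qed.

(* One half of the interval, with the endpoint at [0] and the midpoint at [h]. *)
Lemma half_interval_bound (h theta M : R) (N : nat) (u : nat -> R -> R) :
  0 < h -> 0 <= theta -> derive_chain (S N) u ->
  (forall t, 0 < t < h -> Rabs (u (S N) t) <= M) ->
  Rabs (RInt (u O) 0 h
        - (sum_n (fun k => (-1) ^ k * (peano_kernel (theta * h) (S k) h * u k h)) N
           + theta * h * u O 0))
  <= M * (h ^ (S N + 1) / INR (fact (S N + 1))
          * quadrature_constant theta (S N)).
Proof.
  intros hh hth hchain hM.
  assert (hcont := fun k x => derive_chain_continuous (S N) u k x hchain).
  set (c := theta * h).
  set (W := fun t : R =>
    sum_n (fun k => (-1) ^ k * (peano_kernel c (S k) t * u k t)) N : R).
  set (r := fun t => peano_kernel c (S N) t * u (S N) t).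
  assert (hrc : forall t, continuous r t).
  { intros t; apply (continuous_mult (peano_kernel c (S N)) (u (S N)));
      [apply continuous_peano_kernel|now apply hcont]. }
  assert (hW : forall t, is_derive W t (u O t + (-1) ^ N * r t)).
  { intros t; apply is_derive_by_parts; intros k hk; apply hchain; lia. }
  (* Only the term [k = 0] survives at the endpoint. *)
  assert (hW0 : W 0 = - c * u O 0).
  { unfold W; clear; induction N as [|N IH].
    - rewrite sum_O; unfold peano_kernel; simpl; field.
    - rewrite sum_Sn, IH, peano_kernel_0; unfold plus; simpl; ring. }
  assert (hI0 : is_RInt (u O) 0 h (RInt (u O) 0 h)).
  { apply (RInt_correct (u O)), ex_RInt_continuous; intros; apply hcont; lia. }
  assert (hIr0 : is_RInt (fun t => (-1) ^ N * r t) 0 h ((-1) ^ N * RInt r 0 h)).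
  { apply (is_RInt_scal r), (RInt_correct r), ex_RInt_continuous; auto. }
  (* The integral of [W'] is evaluated twice, by linearity and by the fundamental theorem; equating
     the values gives the integration by parts formula. *)
  assert (hsum := is_RInt_plus _ _ _ _ _ _ hI0 hIr0).
  assert (hftc : is_RInt (fun t => plus (u O t) ((-1) ^ N * r t)) 0 h
                   (minus (W h) (W 0))).
  { apply (is_RInt_derive W); intros t _; [apply hW|].
    apply (continuous_plus (u O) (fun t => (-1) ^ N * r t)); [apply hcont; lia|].
    now apply (continuous_scal_r ((-1) ^ N) r). }
  apply (@is_RInt_unique R_CompleteNormedModule) in hsum.
  apply (@is_RInt_unique R_CompleteNormedModule) in hftc.
  assert (hparts : RInt (u O) 0 h + (-1) ^ N * RInt r 0 h = W h - W 0)
    by exact (eq_trans (eq_sym hsum) hftc).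
  rewrite hW0 in hparts.
  fold (W h).
  replace (RInt (u O) 0 h - (W h + c * u O 0)) with (- ((-1) ^ N * RInt r 0 h))
    by lra.
  rewrite Rabs_Ropp, Rabs_mult, pow_1_abs, Rmult_1_l.
  apply RInt_peano_kernel_bound; auto.
Qed.

(** * Change of variable on each half, and the quadrature formula as boundary terms *)

(** Used with [s = 1], [p = a] for the left half and [s = -1], [p = b] for the right half, traversed
    from [b] inwards; the chain rule contributes [s ^ k]. *)
Lemma derive_chain_affine (n : nat) (G : nat -> R -> R) (s p : R) :
  derive_chain n G -> derive_chain n (fun k t => s ^ k * G k (s * t + p)).
Proof.
  intros hG.
  assert (haff : forall x, is_derive (fun t => s * t + p) x s)
    by (intros x; auto_derive; [easy|ring]).
  split.
  - intros k x hk.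
    replace (s ^ S k * G (S k) (s * x + p))
      with (s ^ k * (s * G (S k) (s * x + p))) by (simpl; ring).
    apply is_derive_scal.
    apply (is_derive_comp (G k) (fun t => s * t + p)); [|apply haff].
    now apply hG.
  - intros x.
    apply (continuous_scal_r (s ^ n) (fun t => G n (s * t + p))).
    apply (continuous_comp (fun t => s * t + p) (G n)); [|apply hG].
    apply (ex_derive_continuous (fun t => s * t + p)); exists s; apply haff.
Qed.

Lemma sum_n_even (c : nat -> R) (N : nat) :
  sum_n (fun k => (1 + (-1) ^ k) * c k) N
  = sum_n (fun i => 2 * c (2 * i)%nat) (N / 2).
Proof.
  (* Both parities are carried together, since [N / 2 = j] for [N = 2j] and for [N = 2j + 1]. *)
  assert (h : forall j,
    sum_n (fun k => (1 + (-1) ^ k) * c k) (2 * j)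
      = sum_n (fun i => 2 * c (2 * i)%nat) j /\
    sum_n (fun k => (1 + (-1) ^ k) * c k) (S (2 * j))
      = sum_n (fun i => 2 * c (2 * i)%nat) j).
  { induction j as [|j [_ IH]].
    - change (2 * 0)%nat with 0%nat; rewrite sum_Sn, !sum_O.
      unfold plus; simpl; split; ring.
    - replace (2 * S j)%nat with (S (S (2 * j))) by lia.
      rewrite !(sum_Sn _ (S _)), IH, (sum_Sn _ j).
      replace (S (S (2 * j))) with (2 * S j)%nat by lia.
      rewrite pow_1_odd, pow_1_even; unfold plus; simpl; split; ring. }
  destruct (Nat.Even_or_Odd N) as [[j ->]|[j ->]].
  - replace (2 * j / 2)%nat with j; [apply h|].
    rewrite Nat.mul_comm, Nat.div_mul; lia.
  - replace ((2 * j + 1) / 2)%nat with j.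
    + rewrite Nat.add_1_r; apply h.
    + apply Nat.div_unique with 1%nat; lia.
Qed.

(** The two sums are the midpoint boundary terms of the left and right halves. The reflection puts
    an extra [(-1) ^ k] into the second, so they combine with coefficient [1 + (-1) ^ k] and only
    even derivatives remain. *)
Lemma quadrature_eq (a b theta : R) (N : nat) (f : R -> R) (G : nat -> R -> R) :
  a < b -> (forall x, segment a b x -> G O x = f x) -> derive_chain (S N) G ->
  let h := (b - a) / 2 in
  let m := (a + b) / 2 in
  let P := peano_kernel (theta * h) in
  quadrature a b theta (S N) f
  = sum_n (fun k => (-1) ^ k * (P (S k) h * G k m)) N
    + sum_n (fun k => (-1) ^ k * (P (S k) h * ((-1) ^ k * G k m))) N
    + theta * h * (G O a + G O b).
Proof.
  intros hab hG0 hchain h m P.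
  assert (hsplit : sum_n (fun k => (-1) ^ k * (P (S k) h * G k m)) N
    + sum_n (fun k => (-1) ^ k * (P (S k) h * ((-1) ^ k * G k m))) N
    = sum_n (fun k => (1 + (-1) ^ k) * (P (S k) h * G k m)) N).
  { rewrite <- (sum_n_plus (G := R_AbelianMonoid)).
    apply sum_n_ext; intros k.
    change ((-1) ^ k * (P (S k) h * G k m)
            + (-1) ^ k * (P (S k) h * ((-1) ^ k * G k m))
            = (1 + (-1) ^ k) * (P (S k) h * G k m)).
    assert (hk : (-1) ^ k * (-1) ^ k = 1).
    { rewrite <- Rpow_mult_distr; replace (-1 * -1) with 1 by ring; apply pow1. }
    transitivity (((-1) ^ k + (-1) ^ k * (-1) ^ k) * (P (S k) h * G k m));
      [ring|rewrite hk; ring]. }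
  (* The term [i = 0] is split off: [2 P_1(h) = (b - a) (1 - theta)] is the weight of the midpoint
     value. *)
  rewrite hsplit, sum_n_even; unfold sum_n; rewrite sum_Sn_m by lia.
  unfold quadrature; replace (S N - 1)%nat with N by lia.
  rewrite !(hG0 a), !(hG0 b) by (unfold segment; lra).
  rewrite (sum_n_m_ext_loc _ (fun i => 2 * (P (S (2 * i)) h * G (2 * i)%nat m))
             1 (N / 2)).
  - change (@plus R_AbelianMonoid) with Rplus; change (2 * 0)%nat with 0%nat.
    rewrite <- (hG0 ((a + b) / 2)) by (unfold segment; lra); fold m.
    unfold P, peano_kernel, h; simpl; field.
  - intros i hi.
    assert (hiN : (2 * i <= N)%nat).
    { pose proof (Nat.div_mod N 2); lia. }
    rewrite (Derive_n_derive_chain (S N) a b f G hG0 hchain) by (lra || lia).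
    fold m; rewrite Nat.add_1_r.
    (* This turns [(b - a)^(2i+1) / 2^(2i)] into [2 h^(2i+1)], to be matched with
       [2 P_(2i+1)(h)]. *)
    replace (b - a) with (2 * h) by (unfold h; field).
    unfold P, peano_kernel; rewrite Nat.pred_succ.
    rewrite Rpow_mult_distr, <- !tech_pow_Rmult.
    match goal with |- @eq _ ?x ?y => change (@eq R x y) end.
    field; split; [apply INR_fact_neq_0|apply pow_nonzero; lra].
Qed.

(** * Joining the estimates on the two halves *)

Theorem theorem6 (a b : R) (hab : a < b) (n : nat) (hn : (1 <= n)%nat)
    (f : R -> R) (hf : Cn_on n a b f)
    (hsup : Rbar_lt (sup_norm a b (Derive_n f n)) p_infty) :
  forall theta : R, 0 <= theta <= 1 ->
  Rabs (RInt f a b - quadrature a b theta n f)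
  <= (b - a) ^ (n + 1) / (INR (fact (n + 1)) * 2 ^ n)
     * real (sup_norm a b (Derive_n f n))
     * (if Rle_dec 1 (theta * INR n)
        then theta * INR (n + 1) - 1
        else 2 * theta ^ (n + 1) * INR n ^ n - theta * INR (n + 1) + 1).
Proof.
  intros theta htheta.
  destruct n as [|N]; [lia|].
  destruct (Cn_on_extend _ a b f hab hf) as [G [hG0 hchain]].
  set (M := real (sup_norm a b (Derive_n f (S N)))).
  fold (quadrature_constant theta (S N)).
  set (h := (b - a) / 2).
  set (m := (a + b) / 2).
  assert (hh : 0 < h) by (unfold h; lra).
  assert (hM : forall x, a < x < b -> Rabs (G (S N) x) <= M).
  { intros x hx.
    rewrite <- (Derive_n_derive_chain (S N) a b f G) by auto.
    now apply sup_norm_ub. }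
  assert (hcont : forall x, continuous (G O) x).
  { intros x; apply (derive_chain_continuous (S N)); [exact hchain|lia]. }
  assert (hex : forall p q, ex_RInt (G O) p q).
  { intros p q; apply (@ex_RInt_continuous R_CompleteNormedModule); auto. }
  assert (hleft := half_interval_bound h theta M N _ hh (proj1 htheta)
                     (derive_chain_affine _ _ 1 a hchain)).
  assert (hright := half_interval_bound h theta M N _ hh (proj1 htheta)
                     (derive_chain_affine _ _ (-1) b hchain)).
  cbv beta in hleft, hright.
  lapply hleft; [clear hleft; intros hleft|].
  2: { intros t ht; rewrite pow1, Rmult_1_l; apply hM; unfold h in ht; lra. }
  lapply hright; [clear hright; intros hright|].
  2: { intros t ht; rewrite Rabs_mult, pow_1_abs, Rmult_1_l.
       apply hM; unfold h in ht; lra. }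
  assert (hIl : RInt (fun t => 1 ^ 0 * G O (1 * t + a)) 0 h = RInt (G O) a m).
  { assert (hlin := RInt_comp_lin (G O) 1 a 0 h (hex _ _)).
    replace (1 * 0 + a) with a in hlin by ring.
    replace (1 * h + a) with m in hlin by (unfold m, h; field).
    rewrite <- hlin; apply RInt_ext; intros x _.
    unfold scal; simpl; unfold mult; simpl; ring. }
  (* The reflection sends [0] to [b] and [h] to [m]; its factor [-1] is absorbed by reversing the
     limits of integration. *)
  assert (hIr : RInt (fun t => (-1) ^ 0 * G O (-1 * t + b)) 0 h = RInt (G O) m b).
  { assert (hlin := RInt_comp_lin (G O) (-1) b 0 h (hex _ _)).
    replace (-1 * 0 + b) with b in hlin by ring.
    replace (-1 * h + b) with m in hlin by (unfold m, h; field).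
    rewrite <- (opp_RInt_swap (G O)), <- hlin by apply hex.
    rewrite <- (RInt_opp (V := R_CompleteNormedModule))
      by apply (ex_RInt_comp_lin (G O)), hex.
    apply RInt_ext; intros x _.
    unfold scal, opp; simpl; unfold mult; simpl; ring. }
  rewrite hIl in hleft; rewrite hIr in hright.
  replace (1 * h + a) with m in hleft by (unfold m, h; field).
  replace (-1 * h + b) with m in hright by (unfold m, h; field).
  replace (1 * 0 + a) with a in hleft by ring.
  replace (-1 * 0 + b) with b in hright by ring.
  rewrite (sum_n_ext _ (fun k =>
    (-1) ^ k * (peano_kernel (theta * h) (S k) h * G k m))) in hleft
    by (intros k; now rewrite pow1, Rmult_1_l).
  rewrite (quadrature_eq a b theta N f G hab hG0 hchain); fold h m.
  assert (hI : RInt f a b = RInt (G O) a m + RInt (G O) m b).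
  { rewrite (RInt_ext f (G O)).
    - symmetry; apply (RInt_Chasles (G O)); apply hex.
    - intros x hx; rewrite Rmin_left, Rmax_right in hx by lra.
      symmetry; apply hG0; unfold segment; lra. }
  rewrite hI.
  match goal with |- Rabs ?e <= ?r =>
    match type of hleft with Rabs ?l <= ?B =>
    match type of hright with Rabs ?l' <= _ =>
      replace e with (l + l') by (simpl; ring);
      replace r with (B + B)
    end end end.
  - eapply Rle_trans; [apply Rabs_triang|now apply Rplus_le_compat].
  (* Two equal bounds with [h^(n+1)] add up to [2 h^(n+1) = (b - a)^(n+1) / 2^n], where
     [n = S N]. *)
  - replace (b - a) with (2 * h) by (unfold h; field).
    rewrite Rpow_mult_distr, (Nat.add_1_r (S N)), <- (tech_pow_Rmult 2).
    field; split; [apply pow_nonzero; lra|apply INR_fact_neq_0].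
Qed.
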